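(* Fix integers $n\geq2$, $d\geq1$, $1\leq p<n$ and set $q:=n-p$. For a commutative ring $R$ and a system $\mathcal{F}=(F^{\{1\}},\ldots,F^{\{n\}})$ of homogeneous polynomials of degree $d$ in $R[x_1,\ldots,x_n]$ which is equivariant with respect to $\mathfrak{S}_{\{1,\ldots,p\}}\times\mathfrak{S}_{\{p+1,\ldots,n\}}$, let $$P(\mathcal{F}):=\left(F^{\{1,\ldots,d+1\}}\right)^{\mu_1}\left(F^{\{p+1,\ldots,p+1+d\}}\right)^{\mu_2}\prod_{\substack{(\lambda,\lambda')\vdash (p,q)\\ r_1\leq d,\ r_2\leq d}}\mathrm{Res}\left(F_{(\lambda,\lambda')}^{\{1\}},\ldots,F_{(\lambda,\lambda')}^{\{1,\ldots,r_1\}},F_{(\lambda,\lambda')}^{\{p+1\}},\ldots,F_{(\lambda,\lambda')}^{\{p+1,\ldots,p+r_2\}}\right)^{m_\lambda m_{\lambda'}}\in R,$$ where $r_1=l(\lambda)$, $r_2=l(\lambda')$, and the first (resp. second) factor is omitted when $p\leq d$ (resp. $q\leq d$). Then the sign $\varepsilon\in\{1,-1\}$ in the decomposition formula $$\mathrm{Res}\left(F^{\{1\}},\ldots,F^{\{n\}}\right)=\varepsilon\,P(\mathcal{F})$$ does not depend on the coefficients of the equivariant system $\mathcal{F}$: it is the same for every such system for which $P(\mathcal{F})$ does not vanish identically. Consequently, for each fixed $(n,p,q,d)$, $\varepsilon$ is entirely determined by evaluating a single non-degenerate example, that is, a single such system with $P(\mathcal{F})\neq0$.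
   Context: Equivariance: a permutation $\sigma\in\mathfrak{S}_n$ acts on polynomials by $\sigma(P):=P(x_{\sigma(1)},\ldots,x_{\sigma(n)})$. The system is equivariant with respect to $G=\mathfrak{S}_{\{1,\ldots,p\}}\times\mathfrak{S}_{\{p+1,\ldots,n\}}$ if $\sigma(F^{\{i\}})=F^{\{\sigma(i)\}}$ for all $\sigma\in G$ and all $i\in\{1,\ldots,n\}$. Divided differences: defined recursively by $F^{\{i_1,\ldots,i_k\}}=\dfrac{F^{\{i_1,\ldots,i_{k-1}\}}-F^{\{i_1,\ldots,i_{k-2},i_k\}}}{x_{i_{k-1}}-x_{i_k}}$ for distinct indices all lying in $\{1,\ldots,p\}$ or all lying in $\{p+1,\ldots,n\}$. For an equivariant system these are polynomials depending only on the set $I=\{i_1,\ldots,i_k\}$, homogeneous of degree $d-|I|+1$ (in particular $F^I\in R$ if $|I|=d+1$). Partitions: a partition $\lambda\vdash m$ of length $l(\lambda)=k$ is a sequence $\lambda_1\geq\cdots\geq\lambda_k\geq1$ with sum $m$. Writing $s_j$ for the number of parts of $\lambda$ equal to $j$, $m_\lambda:=\frac{1}{\prod_{j=1}^m s_j!}\cdot\frac{m!}{\lambda_1!\cdots\lambda_k!}$. The notation $(\lambda,\lambda')\vdash(p,q)$ means $\lambda\vdash p$ and $\lambda'\vdash q$. Exponents: $\mu_1:=d^{\,q}m_0(p,d)$ and $\mu_2:=d^{\,p}m_0(q,d)$, where for $m,d\geq1$, $m_0(m,d):=m\,d^{m-1}-\sum_{\mu\vdash m,\ l(\mu)\leq d}m_\mu\left(\sum_{j=1}^{l(\mu)}\frac{d(d-1)\cdots(d-l(\mu)+1)}{d-j+1}\right)$.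 Specialization: given $(\lambda,\lambda')\vdash(p,q)$, let $\rho_{(\lambda,\lambda')}:R[x_1,\ldots,x_n]\to R[y_1,\ldots,y_{r_1},y'_1,\ldots,y'_{r_2}]$ be the $R$-algebra morphism sending the first $\lambda_1$ of $x_1,\ldots,x_p$ to $y_1$, the next $\lambda_2$ to $y_2$, and so on, and the first $\lambda'_1$ of $x_{p+1},\ldots,x_n$ to $y'_1$, the next $\lambda'_2$ to $y'_2$, and so on. For $1\leq i\leq r_1$, $F_{(\lambda,\lambda')}^{\{1,\ldots,i\}}:=\rho_{(\lambda,\lambda')}(F^{\{j_1,\ldots,j_i\}})$ with $j_t\in\{1,\ldots,p\}$ any index such that $\rho_{(\lambda,\lambda')}(x_{j_t})=y_t$; for $1\leq i\leq r_2$, $F_{(\lambda,\lambda')}^{\{p+1,\ldots,p+i\}}:=\rho_{(\lambda,\lambda')}(F^{\{j'_1,\ldots,j'_i\}})$ with $j'_t\in\{p+1,\ldots,n\}$ any index such that $\rho_{(\lambda,\lambda')}(x_{j'_t})=y'_t$. These do not depend on the choices. In the resultants, the variables are ordered $y_1,\ldots,y_{r_1},y'_1,\ldots,y'_{r_2}$. Resultant: $\mathrm{Res}$ of $N$ homogeneous polynomials of positive degrees $d_1,\ldots,d_N$ in $N$ variables over a commutative ring is the specialization of the universal resultant, i.e. of the unique generator of the degree-zero part of the ideal of inertia forms $(f_1,\ldots,f_N):(x_1,\ldots,x_N)^\infty$ of the generic polynomials over the ring $\mathbb{Z}[\text{coefficients}]$ normalized by $\mathrm{Res}(x_1^{d_1},\ldots,x_N^{d_N})=1$.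 The decomposition formula $\mathrm{Res}(F^{\{1\}},\ldots,F^{\{n\}})=\varepsilon\,P(\mathcal{F})$, for some sign $\varepsilon\in\{1,-1\}$, is established beforehand for these equivariant systems; the statement concerns the sign in it.
   Formalization: For the sign to be determined by a system, the condition P(F) ≠ 0 is replaced by 2P(F) ≠ 0: if 2P(F) = 0 (e.g. over F_2, where P(F) may be 1) both signs satisfy the formula and the example determines nothing. *)

(* Defs.v *)
From mathcomp Require Import all_boot all_order all_fingroup all_algebra.
From mathcomp.multinomials Require Import mpoly.
From Stdlib Require Import ClassicalEpsilon.

Set Implicit Arguments.
Unset Strict Implicit.
Unset Printing Implicit Defensive.

Import GRing.Theory.

Local Open Scope ring_scope.

(* Indices are 0-based throughout: the paper's x_1, .., x_n are
   'X_0, .., 'X_(n-1), and the block {1, .., p} is {i : 'I_n | i < p}. *)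

Section Resultant.

Variables (N : nat) (D : 'I_N -> nat).

(* The coefficients of N generic forms of degrees D: pairs of the index of a
   form and of a monomial of the degree of that form. *)
Definition gcoef : finType :=
  {im : 'I_N * 'X_{1..N < (\max_(i < N) D i).+1} | mdeg im.2 == D im.1}.

Definition gcoef_form (k : 'I_#|gcoef|) : 'I_N := (val (enum_val k)).1.

Definition gcoef_mon (k : 'I_#|gcoef|) : 'X_{1..N} := (val (enum_val k)).2.

(* ZZ[coefficients] *)
Definition coef_ring : comNzRingType := {mpoly int[#|gcoef|]}.

Definition generic_form (i : 'I_N) : {mpoly coef_ring[N]} :=
  \sum_(k < #|gcoef| | gcoef_form k == i)
     ('X_k : coef_ring) *: 'X_[gcoef_mon k].

Definition in_generic_ideal (g : {mpoly coef_ring[N]}) : Prop :=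
  exists h : 'I_N -> {mpoly coef_ring[N]}, g = \sum_i h i * generic_form i.

(* a belongs to (f_1, .., f_N) : (x_1, .., x_N)^oo, for a of degree 0 in x *)
Definition inertia0 (a : coef_ring) : Prop :=
  exists k : nat, forall m : 'X_{1..N}, mdeg m = k ->
    in_generic_ideal (a *: 'X_[m]).

(* The value of a polynomial in the generic coefficients at the coefficients
   of f. Only the coefficients of f i in degree D i are used. *)
Definition specialize (r : coef_ring) (R : comNzRingType)
    (f : 'I_N -> {mpoly R[N]}) : R :=
  mmap (intr : int -> R) (fun k => (f (gcoef_form k))@_(gcoef_mon k)) r.

Definition is_universal_resultant (r : coef_ring) : Prop :=
  (forall a : coef_ring, inertia0 a <-> exists b : coef_ring, a = b * r)
  /\ specialize r (fun i => 'X_i ^+ D i : {mpoly int[N]}) = 1.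

(* For N >= 1 and positive D, exactly one element satisfies
   is_universal_resultant; other N and D are never used. *)
Definition universal_resultant : coef_ring :=
  epsilon (inhabits 0) is_universal_resultant.

Definition resultant (R : comNzRingType) (f : 'I_N -> {mpoly R[N]}) : R :=
  specialize universal_resultant f.

End Resultant.

(* The values in 'I_n of a sequence of natural numbers (those >= n, which do
   not occur below, are dropped). *)
Definition ords (n : nat) (s : seq nat) : seq 'I_n := pmap insub s.

Section System.

Variables (n : nat) (R : comNzRingType) (F : 'I_n -> {mpoly R[n]}).

(* msym s P = P(x_(s 1), .., x_(s n)); a permutation is in
   S_{1..p} x S_{p+1..n} iff it preserves {i | i < p}. *)
Definition equivariant (p : nat) : Prop :=
  forall s : 'S_n, (forall i : 'I_n, (s i < p)%N = (i < p)%N) ->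
    forall i : 'I_n, msym s (F i) = F (s i).

Definition equivariant_system (d p : nat) : Prop :=
  (forall i : 'I_n, F i \is d.-homog) /\ equivariant p.

(* ddiff_rev j_k [:: j_(k-1); ..; j_1] = F^{j_1, .., j_k}. The quotient is
   unique since 'X_i - 'X_j is not a zero divisor for i != j, and it exists for
   an equivariant F and distinct indices in the same block. *)
Fixpoint ddiff_rev (j : 'I_n) (s : seq 'I_n) : {mpoly R[n]} :=
  if s is i :: s' then
    epsilon (inhabits 0) (fun Q : {mpoly R[n]} =>
      Q * ('X_i - 'X_j) = ddiff_rev i s' - ddiff_rev j s')
  else F j.

Definition ddiff (s : seq 'I_n) : {mpoly R[n]} :=
  if rev s is j :: s' then ddiff_rev j s' else 0.

(* The divided differences of order d + 1 are constants when F is homogeneous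
   of degree d; this is the constant, as an element of R. *)
Definition ddiff_const (s : seq 'I_n) : R := (ddiff s)@_0%MM.

Section Specialization.

Variables (p r1 r2 : nat) (l1 l2 : seq nat).

Definition spec_index (i : nat) : nat :=
  if (i < p)%N then reshape_index l1 i
  else (r1 + reshape_index l2 (i - p))%N.

(* The morphism rho, onto polynomials in y_1, .., y_r1, y'_1, .., y'_r2. The
   default 0 is not used when l1 and l2 are partitions of p and n - p, of
   lengths r1 and r2. *)
Definition spec_poly (P : {mpoly R[n]}) : {mpoly R[r1 + r2]} :=
  P \mPo [tuple oapp (fun k : 'I_(r1 + r2) => 'X_k) 0 (insub (spec_index i))
         | i < n].

(* The system under the resultant in the factor of index (l1, l2);
   flatten_index l t 0 is the first index of the t-th block. *)
Definition spec_system (k : 'I_(r1 + r2)) : {mpoly R[r1 + r2]} :=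
  match split k with
  | inl i => spec_poly (ddiff (ords n
               [seq flatten_index l1 t 0 | t <- iota 0 i.+1]))
  | inr i => spec_poly (ddiff (ords n
               [seq (p + flatten_index l2 t 0)%N | t <- iota 0 i.+1]))
  end.

End Specialization.

End System.

(* |I| = i + 1 for the 0-based i in the block, whence degree d - i. *)
Definition spec_degree (d r1 r2 : nat) (k : 'I_(r1 + r2)) : nat :=
  match split k with inl i => (d - i)%N | inr i => (d - i)%N end.

Definition is_partition (m : nat) (s : seq nat) : bool :=
  [&& sorted geq s, all (leq 1) s & sumn s == m].

(* Every part of a partition of m is at most m, so these tuples carry all the
   partitions of m of length k. *)
Definition parts (m k : nat) (t : k.-tuple 'I_m.+1) : seq nat :=
  [seq nat_of_ord i | i <- t].

Section Multiplicities.

Local Open Scope nat_scope.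

(* The division is exact. *)
Definition mult (m : nat) (l : seq nat) : nat :=
  m`! %/ ((\prod_(1 <= j < m.+1) (count_mem j l)`!) * \prod_(a <- l) a`!).

(* Both the division and the subtraction are exact: m0 m d >= 0. *)
Definition m0 (m d : nat) : nat :=
  m * d ^ m.-1
  - \sum_(k < d.+1) \sum_(t : k.-tuple 'I_m.+1 | is_partition m (parts t))
      mult m (parts t) * \sum_(1 <= j < k.+1) (d ^_ k) %/ (d - j + 1).

Definition mu1 (d p q : nat) : nat := d ^ q * m0 p d.

Definition mu2 (d p q : nat) : nat := d ^ p * m0 q d.

End Multiplicities.

Definition decomposition_product (n d p : nat) (R : comNzRingType)
    (F : 'I_n -> {mpoly R[n]}) : R :=
  let q := (n - p)%N in
  (if (p <= d)%N then 1
   else ddiff_const F (ords n (iota 0 d.+1)) ^+ mu1 d p q)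
  * (if (q <= d)%N then 1
     else ddiff_const F (ords n (iota p d.+1)) ^+ mu2 d p q)
  * \prod_(r1 < d.+1)
    \prod_(t1 : r1.-tuple 'I_p.+1 | is_partition p (parts t1))
    \prod_(r2 < d.+1)
    \prod_(t2 : r2.-tuple 'I_q.+1 | is_partition q (parts t2))
      resultant (@spec_degree d r1 r2)
                (spec_system F p (parts t1) (parts t2))
        ^+ (mult p (parts t1) * mult q (parts t2))%N.

Definition is_sign (eps : int) : Prop := eps = 1 \/ eps = -1.

Definition decomposition_with_sign (n d p : nat) (R : comNzRingType)
    (F : 'I_n -> {mpoly R[n]}) (eps : int) : Prop :=
  resultant (fun _ : 'I_n => d) F = eps%:~R * decomposition_product d p F.

(* Main.v *)
Require Import Defs.
From HB Require Import structures.
From mathcomp Require Import all_boot all_order all_fingroup all_algebra.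
From mathcomp.multinomials Require Import mpoly.
From Stdlib Require Import ClassicalEpsilon.

Set Implicit Arguments.
Unset Strict Implicit.
Unset Printing Implicit Defensive.

Import GRing.Theory.

Local Open Scope ring_scope.

(** There is one equivariant system of which all others are specializations.
    Equivariance says exactly that the coefficient of x^m in F^{i} depends only
    on the orbit of (i, m) under S_{1..p} x S_{p+1..n}.  Taking one indeterminate
    per orbit gives an equivariant system over a polynomial ring over the
    integers, the universal system, and every equivariant system F over R is its
    image under the morphism that evaluates each indeterminate at the common
    coefficient of F on the orbit ([universal_systemP]).

    Both sides of the decomposition formula commute with ring morphisms applied
    to the coefficients.  For resultants this is immediate, as they are values of
    a fixed integer polynomial in the coefficients ([resultant_map]).  For the
    divided differences, which are only characterized as quotients, it needs that
    the quotients exist and are unique over every commutative ring.  They exist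
    because the two terms of the numerator are exchanged by the transposition of
    the two indices involved, and any P is congruent to its image under that
    transposition modulo x_i - x_j ([subX_dvd_sub_msym], [msym_ddiff_rev]); they
    are unique because x_i - x_j is not a zero divisor, even when R has zero
    divisors ([mulr_subXI]).

    A sign that is valid for the universal system is therefore valid for all
    systems.  If F admitted the opposite sign as well, then P(F) = - P(F), so a
    system with 2 P(F) <> 0 determines the sign. *)

(** * Divisibility by a difference of two variables *)

Lemma mcoeffMX_eq0 (n : nat) (R : comNzRingType) (Q : {mpoly R[n]}) (i : 'I_n)
    (m : 'X_{1..n}) : m i = 0%N -> (Q * 'X_i)@_m = 0.
Proof.
move=> mi0; apply: memN_msupp_eq0; rewrite (perm_mem (msuppMX _ _)).
by apply/mapP => -[m' _ em]; move: mi0; rewrite em mnmDE mnm1E eqxx.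
Qed.

(** If Q x_i = Q x_j, then comparing the coefficients of a monomial m x_j gives
    Q_m = 0 when x_i does not divide m, and Q_m = Q_(m x_j / x_i) otherwise, so
    that the exponent of x_i can be lowered to 0. *)
Lemma mulr_subX_eq0 (n : nat) (R : comNzRingType) (i j : 'I_n)
    (Q : {mpoly R[n]}) : i != j -> Q * ('X_i - 'X_j) = 0 -> Q = 0.
Proof.
move=> ij /eqP; rewrite mulrBr subr_eq0 => /eqP eQ.
apply/mpolyP => m; rewrite mcoeff0.
have [k] := ubnP (m i); elim: k m => // k IH m /ltnSE mk.
have [mi0|mi0] := eqVneq (m i) 0%N.
  rewrite -(mcoeffMX Q U_(j)) -eQ mcoeffMX_eq0 //.
  by rewrite mnmDE mnm1E eq_sym (negbTE ij) mi0.
have le1 : (U_(i) <= m)%MM by rewrite lep1mP.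
rewrite -(mcoeffMX Q U_(j)) -eQ -{1}(submK le1) addmC -addmA addmC -addmA.
rewrite mcoeffMX; apply: IH.
rewrite mnmDE mnmBE !mnm1E eqxx eq_sym (negbTE ij) add0n subn1.
by rewrite prednK // lt0n.
Qed.

Lemma mulr_subXI (n : nat) (R : comNzRingType) (i j : 'I_n) : i != j ->
  injective (fun Q : {mpoly R[n]} => Q * ('X_i - 'X_j)).
Proof.
move=> ij P Q /eqP; rewrite -subr_eq0 -mulrBl => /eqP /(mulr_subX_eq0 ij) /eqP.
by rewrite subr_eq0 => /eqP.
Qed.

Lemma msymXU (n : nat) (R : comNzRingType) (s : 'S_n) (i : 'I_n) :
  msym s 'X_i = 'X_(s i) :> {mpoly R[n]}.
Proof. by rewrite /msym mmapX mmap1U. Qed.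

(** Modulo x_i - x_j the transposition of x_i and x_j fixes every variable, and
    the polynomials congruent to their image form a subalgebra. *)
Lemma subX_dvd_sub_msym (n : nat) (R : comNzRingType) (i j : 'I_n)
    (P : {mpoly R[n]}) :
  exists Q, Q * ('X_i - 'X_j) = P - msym (tperm i j) P.
Proof.
pose C (P : {mpoly R[n]}) :=
  exists Q, Q * ('X_i - 'X_j) = P - msym (tperm i j) P.
have CM P1 P2 : C P1 -> C P2 -> C (P1 * P2).
  move=> [Q1 e1] [Q2 e2]; exists (Q1 * P2 + msym (tperm i j) P1 * Q2).
  rewrite mulrDl mulrAC e1 -mulrA e2 msymM mulrBl mulrBr.
  by rewrite addrA subrK.
have C1 : C 1 by exists 0; rewrite mul0r msym1 subrr.
have CX k : C 'X_k.
  rewrite /C msymXU; case: tpermP => [->|->|_ _].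
  - by exists 1; rewrite mul1r.
  - by exists (-1); rewrite mulN1r opprB.
  - by exists 0; rewrite mul0r subrr.
rewrite -/(C P); elim/mpolyind: P => [|c m P _ _ [Q e]].
  by exists 0; rewrite mul0r msym0 subrr.
have [Q' e'] : C 'X_[m].
  rewrite mpolyXE_id; apply: big_ind => // k _.
  by elim: (m k) => [|l IH]; rewrite ?expr0 // exprS; apply: CM.
exists (c *: Q' + Q).
by rewrite mulrDl -scalerAl e e' scalerBr msymD msymZ opprD addrACA.
Qed.

(** * Divided differences of an equivariant system *)

Definition preserves_block (n p : nat) (s : 'S_n) : Prop :=
  forall i : 'I_n, (s i < p)%N = (i < p)%N.

Definition in_block (n p : nat) (b : bool) (s : seq 'I_n) : bool :=
  all (fun i : 'I_n => (i < p)%N == b) s.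

Lemma preserves_block_tperm (n p : nat) (b : bool) (i j : 'I_n) :
  (i < p)%N = b -> (j < p)%N = b -> preserves_block p (tperm i j).
Proof. by move=> ib jb k; case: tpermP => [->|->|]; rewrite ?ib ?jb. Qed.

Lemma map_tperm_id (T : finType) (i j : T) (s : seq T) :
  i \notin s -> j \notin s -> map (tperm i j) s = s.
Proof.
move=> si sj; rewrite -[RHS]map_id; apply/eq_in_map => k ks /=.
by apply: tpermD; apply: contraTneq ks => <-.
Qed.

(** The quotient that defines a divided difference exists as soon as the two
    terms of the numerator are exchanged by the transposition. *)
Lemma ddiff_rev_eq (n : nat) (R : comNzRingType) (F : 'I_n -> {mpoly R[n]})
    (i j : 'I_n) (s : seq 'I_n) :
  msym (tperm i j) (ddiff_rev F i s) = ddiff_rev F j s ->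
  ddiff_rev F j (i :: s) * ('X_i - 'X_j) = ddiff_rev F i s - ddiff_rev F j s.
Proof.
move=> sym /=.
pose quot (Q : {mpoly R[n]}) :=
  Q * ('X_i - 'X_j) = ddiff_rev F i s - ddiff_rev F j s.
apply: (epsilon_spec (inhabits 0) quot); rewrite /quot -sym.
exact: subX_dvd_sub_msym.
Qed.

(** The equivariance of F passes to its divided differences.  The induction
    yields along the way the existence of the quotients: the transposition (i j)
    fixes the remaining indices js, so by induction it takes the divided
    difference at i, js to the one at j, js. *)
Lemma msym_ddiff_rev (n p : nat) (R : comNzRingType) (F : 'I_n -> {mpoly R[n]})
    (b : bool) (s : 'S_n) (j : 'I_n) (js : seq 'I_n) :
  equivariant F p -> preserves_block p s ->
  uniq (j :: js) -> in_block p b (j :: js) ->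
  msym s (ddiff_rev F j js) = ddiff_rev F (s j) (map s js).
Proof.
move=> eqF; elim: js j s => [|i js IH] j s sp; first by move=> _ _; exact: eqF.
move=> ujs bjs.
have [ij ijs jjs ujs'] : [/\ i != j, i \notin js, j \notin js & uniq js].
  move: ujs; rewrite /= inE negb_or eq_sym.
  by case/andP=> /andP[-> ->] /andP[-> ->].
have /and3P[/eqP jb /eqP ib jsb] := bjs.
(* The images under t are needed too: the divided difference at the permuted
   indices must be known to be a quotient before the two sides are compared. *)
have swap : forall (t : 'S_n), preserves_block p t ->
    msym (tperm (t i) (t j)) (ddiff_rev F (t i) (map t js))
    = ddiff_rev F (t j) (map t js).
  move=> t tp.
  have tij : preserves_block p (tperm (t i) (t j)).
    by apply: (@preserves_block_tperm _ _ b); rewrite tp.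
  have IHi u : preserves_block p u ->
      msym u (ddiff_rev F i js) = ddiff_rev F (u i) (map u js).
    by move=> up; apply: IH; rewrite //= ?ijs // ib eqxx.
  rewrite -IHi // -msymMm IHi => [|k]; last by rewrite permM tij tp.
  rewrite permM tpermL; congr ddiff_rev.
  transitivity (map (tperm (t i) (t j)) (map t js)).
    by rewrite -map_comp; apply: eq_map => k; rewrite permM.
  by rewrite map_tperm_id // mem_map //; apply: perm_inj.
have sij : s i != s j by rewrite (inj_eq perm_inj).
apply: (mulr_subXI sij) => /=.
rewrite -/(ddiff_rev F (s j) (s i :: map s js)) ddiff_rev_eq; last exact: swap.
rewrite -!msymXU -msymB -msymM -/(ddiff_rev F j (i :: js)) ddiff_rev_eq.
  by rewrite msymB !IH ?{1}/in_block //= ?jjs ?ijs ?ujs' ?ib ?jb ?eqxx.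
have := swap 1%g; rewrite !perm1 map_id_in => [|k _]; last by rewrite perm1.
by apply=> k; rewrite perm1.
Qed.

Lemma ddiff_rev_quotient (n p : nat) (R : comNzRingType)
    (F : 'I_n -> {mpoly R[n]}) (b : bool) (i j : 'I_n) (s : seq 'I_n) :
  equivariant F p -> uniq [:: j, i & s] -> in_block p b [:: j, i & s] ->
  ddiff_rev F j (i :: s) * ('X_i - 'X_j) = ddiff_rev F i s - ddiff_rev F j s.
Proof.
move=> eqF; rewrite /= inE negb_or => /andP[/andP[ij js] /andP[ijs us]].
case/and3P=> /eqP jb /eqP ib sb; apply: ddiff_rev_eq.
rewrite (@msym_ddiff_rev _ p _ _ b) //= ?ijs ?ib ?eqxx //.
  by rewrite tpermL map_tperm_id.
by apply: (@preserves_block_tperm _ _ b).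
Qed.

(** * Change of the ring of coefficients *)

Definition base_change (n : nat) (R S : comNzRingType) (f : {rmorphism R -> S})
    (F : 'I_n -> {mpoly R[n]}) (G : 'I_n -> {mpoly S[n]}) : Prop :=
  forall i, G i = map_mpoly f (F i).

Lemma equivariant_base_change (n p : nat) (R S : comNzRingType)
    (f : {rmorphism R -> S}) (F : 'I_n -> {mpoly R[n]})
    (G : 'I_n -> {mpoly S[n]}) :
  base_change f F G -> equivariant F p -> equivariant G p.
Proof.
move=> fFG eqF s sp i; rewrite !fFG -eqF //.
by apply/mpolyP => m; rewrite mcoeff_sym !mcoeff_map_mpoly mcoeff_sym.
Qed.

(** The image of the quotient over R is a quotient over S, and there is only one
    of these. *)
Lemma ddiff_rev_base_change (n p : nat) (R S : comNzRingType)
    (f : {rmorphism R -> S}) (F : 'I_n -> {mpoly R[n]})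
    (G : 'I_n -> {mpoly S[n]}) (b : bool) (j : 'I_n) (s : seq 'I_n) :
  base_change f F G -> equivariant F p ->
  uniq (j :: s) -> in_block p b (j :: s) ->
  ddiff_rev G j s = map_mpoly f (ddiff_rev F j s).
Proof.
move=> fFG eqF; have eqG := equivariant_base_change fFG eqF.
elim: s j => [|i s IH] j u bl; first exact: fFG.
have ij : i != j by move: u; rewrite /= inE negb_or eq_sym; case: eqP.
apply: (mulr_subXI ij) => /=.
rewrite -/(ddiff_rev G j (i :: s)) -/(ddiff_rev F j (i :: s)).
rewrite (ddiff_rev_quotient eqG u bl).
rewrite -(map_mpolyX f U_(i)) -(map_mpolyX f U_(j)) -rmorphB -rmorphM.
rewrite (ddiff_rev_quotient eqF u bl) rmorphB /=.
have [ub uj] : uniq (i :: s) /\ uniq (j :: s).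
  by move: u; rewrite /= inE negb_or => /andP[/andP[_ ->] /andP[-> ->]].
have /and3P[jb ib sb] := bl.
by congr (_ - _); apply: IH => //; apply/andP.
Qed.

Lemma ddiff_base_change (n p : nat) (R S : comNzRingType)
    (f : {rmorphism R -> S}) (F : 'I_n -> {mpoly R[n]})
    (G : 'I_n -> {mpoly S[n]}) (b : bool) (s : seq 'I_n) :
  base_change f F G -> equivariant F p -> uniq s -> in_block p b s ->
  ddiff G s = map_mpoly f (ddiff F s).
Proof.
move=> fFG eqF; rewrite /ddiff -rev_uniq /in_block -all_rev.
case: (rev s) => [|j s'] us bs; first by rewrite rmorph0.
exact: (ddiff_rev_base_change fFG eqF us bs).
Qed.

Lemma uniq_ords (n : nat) (s : seq nat) : uniq s -> uniq (ords n s).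
Proof. exact: pmap_sub_uniq. Qed.

Lemma in_block_ords (n p : nat) (b : bool) (s : seq nat) :
  all (fun k => (k < p)%N == b) s -> in_block p b (ords n s).
Proof. by move=> /allP sb; apply/allP => i; rewrite mem_pmap_sub => /sb. Qed.

(** Unlike in [map_mpoly_comp], f may kill coefficients, as evaluation of the
    universal system does. *)
Lemma map_mpoly_comp_mpoly (n k : nat) (R S : comNzRingType)
    (f : {rmorphism R -> S}) (P : {mpoly R[n]}) (t : n.-tuple {mpoly R[k]})
    (u : n.-tuple {mpoly S[k]}) :
  (forall i, tnth u i = map_mpoly f (tnth t i)) ->
  map_mpoly f (P \mPo t) = map_mpoly f P \mPo u.
Proof.
move=> tu; rewrite comp_mpolyEX (raddf_sum (map_mpoly f)) [in RHS](mpolyE P).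
rewrite (raddf_sum (map_mpoly f)) (raddf_sum (comp_mpoly u)).
apply: eq_bigr => m _; rewrite /= !map_mpolyZ map_mpolyX comp_mpolyZ.
rewrite !comp_mpolyX rmorph_prod; congr (_ *: _); apply: eq_bigr => i _.
by rewrite rmorphXn /= tu.
Qed.

Lemma spec_poly_map (n p r1 r2 : nat) (l1 l2 : seq nat) (R S : comNzRingType)
    (f : {rmorphism R -> S}) (P : {mpoly R[n]}) :
  spec_poly p r1 r2 l1 l2 (map_mpoly f P)
  = map_mpoly f (spec_poly p r1 r2 l1 l2 P).
Proof.
symmetry; apply: map_mpoly_comp_mpoly => i; rewrite !tnth_mktuple.
by case: insub => [k|] /=; rewrite ?map_mpolyX ?rmorph0.
Qed.

(** The resultant is the value at the coefficients of an integer polynomial that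
    is the same for all rings. *)
Lemma resultant_map (N : nat) (D : 'I_N -> nat) (R S : comNzRingType)
    (f : {rmorphism R -> S}) (A : 'I_N -> {mpoly R[N]})
    (B : 'I_N -> {mpoly S[N]}) :
  base_change f A B -> Defs.resultant D B = f (Defs.resultant D A).
Proof.
move=> fAB; rewrite /Defs.resultant /specialize.
move: (universal_resultant D) => r; rewrite /mmap rmorph_sum.
apply: eq_bigr => m _; rewrite rmorphM /= rmorph_int; congr (_ * _).
rewrite /mmap1 rmorph_prod; apply: eq_bigr => k _.
by rewrite rmorphXn /= fAB mcoeff_map_mpoly.
Qed.


(** * The decomposition formula under a change of ring *)

(** The parts of a partition are positive, so its blocks are nonempty and start
    at distinct indices, which the divided differences require. *)
Lemma flatten_index0_ltn (m : nat) (l : seq nat) (t u : nat) :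
  is_partition m l -> (t < u < size l)%N ->
  (flatten_index l t 0 < flatten_index l u 0)%N.
Proof.
case/and3P=> _ /allP pos _ /andP[tu ul].
have tl := ltn_trans tu ul.
rewrite /flatten_index !addn0 -(subnKC tu) takeD sumn_cat (take_nth 0%N) //.
rewrite sumn_rcons -addnA -[X in (X < _)%N]addn0 ltn_add2l ltn_addr //.
by apply: pos; rewrite mem_nth.
Qed.

Lemma flatten_index0_bound (m : nat) (l : seq nat) (t : nat) :
  is_partition m l -> (t < size l)%N -> (flatten_index l t 0 < m)%N.
Proof.
case/and3P=> _ /allP pos /eqP <- tl; apply: flatten_indexP.
by apply: pos; rewrite mem_nth.
Qed.

Lemma uniq_flatten_index0 (m : nat) (l : seq nat) (i : nat) :
  is_partition m l -> (i < size l)%N ->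
  uniq [seq flatten_index l t 0 | t <- iota 0 i.+1].
Proof.
move=> part il; rewrite map_inj_in_uniq ?iota_uniq // => t u.
rewrite !mem_iota /= !add0n !ltnS => ti ui e.
have lt_ne t' u' : (t' < u' <= i)%N ->
    flatten_index l t' 0 <> flatten_index l u' 0.
  case/andP=> tu' ui'; apply/eqP; rewrite ltn_eqF //.
  rewrite (flatten_index0_ltn part) //.
  by rewrite tu' (leq_ltn_trans ui').
case: (ltngtP t u) => // tu.
  by case: (lt_ne t u); rewrite ?tu.
by case: (lt_ne u t); rewrite ?tu.
Qed.

Lemma spec_system_base_change (n p : nat) (R S : comNzRingType)
    (f : {rmorphism R -> S}) (F : 'I_n -> {mpoly R[n]})
    (G : 'I_n -> {mpoly S[n]}) (r1 r2 : nat) (t1 : r1.-tuple 'I_p.+1)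
    (t2 : r2.-tuple 'I_(n - p).+1) :
  base_change f F G -> equivariant F p ->
  is_partition p (parts t1) -> is_partition (n - p) (parts t2) ->
  base_change f (@spec_system n R F p r1 r2 (parts t1) (parts t2))
                (spec_system G p (parts t1) (parts t2)).
Proof.
move=> fFG eqF part1 part2 k; rewrite /spec_system.
have size_parts m r (t : r.-tuple 'I_m.+1) : size (parts t) = r.
  by rewrite size_map size_tuple.
case: split => i; rewrite -spec_poly_map; congr spec_poly.
  have ir : (i < size (parts t1))%N by rewrite size_parts.
  apply: (ddiff_base_change fFG eqF (b := true)).
    exact: uniq_ords (uniq_flatten_index0 part1 ir).
  apply: in_block_ords; apply/allP => _ /mapP[t + ->].
  rewrite mem_iota /= add0n ltnS => ti.
  by rewrite (flatten_index0_bound part1) // (leq_ltn_trans ti).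
have ir : (i < size (parts t2))%N by rewrite size_parts.
apply: (ddiff_base_change fFG eqF (b := false)).
  apply: uniq_ords; rewrite (map_comp (addn p)) (map_inj_uniq (@addnI p)).
  exact: uniq_flatten_index0 part2 ir.
by apply: in_block_ords; apply/allP => _ /mapP[t _ ->]; rewrite ltnNge leq_addr.
Qed.

Lemma ddiff_const_base_change (n p : nat) (R S : comNzRingType)
    (f : {rmorphism R -> S}) (F : 'I_n -> {mpoly R[n]})
    (G : 'I_n -> {mpoly S[n]}) (b : bool) (s : seq nat) :
  base_change f F G -> equivariant F p ->
  uniq s -> all (fun k => (k < p)%N == b) s ->
  ddiff_const G (ords n s) = f (ddiff_const F (ords n s)).
Proof.
move=> fFG eqF us bs; rewrite /ddiff_const.
rewrite (ddiff_base_change fFG eqF (uniq_ords _ us) (in_block_ords _ bs)).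
exact: mcoeff_map_mpoly.
Qed.

Lemma decomposition_product_base_change (n d p : nat) (R S : comNzRingType)
    (f : {rmorphism R -> S}) (F : 'I_n -> {mpoly R[n]})
    (G : 'I_n -> {mpoly S[n]}) :
  base_change f F G -> equivariant F p ->
  decomposition_product d p G = f (decomposition_product d p F).
Proof.
move=> fFG eqF; rewrite /decomposition_product !rmorphM.
congr (_ * _ * _).
- case: leqP => [_|dp]; first by rewrite rmorph1.
  rewrite rmorphXn (ddiff_const_base_change (b := true) fFG eqF) ?iota_uniq //.
  by apply/allP => k; rewrite mem_iota /= add0n => /leq_trans ->.
- case: leqP => [_|dq]; first by rewrite rmorph1.
  rewrite rmorphXn (ddiff_const_base_change (b := false) fFG eqF) ?iota_uniq //.
  by apply/allP => k; rewrite mem_iota => /andP[pk _]; rewrite ltnNge pk.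
rewrite rmorph_prod; apply: eq_bigr => r1 _.
rewrite rmorph_prod; apply: eq_bigr => t1 part1.
rewrite rmorph_prod; apply: eq_bigr => r2 _.
rewrite rmorph_prod; apply: eq_bigr => t2 part2.
rewrite rmorphXn /=; congr (_ ^+ _); apply: resultant_map.
exact: spec_system_base_change.
Qed.

Lemma decomposition_with_sign_base_change (n d p : nat) (R S : comNzRingType)
    (f : {rmorphism R -> S}) (F : 'I_n -> {mpoly R[n]})
    (G : 'I_n -> {mpoly S[n]}) (eps : int) :
  base_change f F G -> equivariant F p ->
  decomposition_with_sign d p F eps -> decomposition_with_sign d p G eps.
Proof.
move=> fFG eqF; rewrite /decomposition_with_sign (resultant_map _ fFG) => ->.
by rewrite rmorphM rmorph_int (decomposition_product_base_change _ fFG eqF).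
Qed.

(** * The universal equivariant system *)

Section UniversalSystem.

Variables (n d p : nat).

Let bounded_pair : finType := ('I_n * 'X_{1..n < d.+1})%type.

(** The coefficient of x^m' in F^{s i} is that of x^(m' o s) in F^{i}, so these
    are the pairs (j, m') at which an equivariant system has the same coefficient
    as at (i, m).  The bound on the degree makes them a finite set, which can
    index an indeterminate. *)
Definition coef_orbit (i : 'I_n) (m : 'X_{1..n}) : {set bounded_pair} :=
  [set jm : bounded_pair | [exists s : 'S_n,
     [&& [forall k, (s k < p)%N == (k < p)%N], jm.1 == s i
       & m == [multinom (jm.2 : 'X_{1..n}) (s k) | k < n]]]].

Lemma coef_orbitP (i : 'I_n) (m : 'X_{1..n}) (j : 'I_n)
    (m' : 'X_{1..n < d.+1}) :
  reflect (exists s : 'S_n, [/\ preserves_block p s, j = s i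
             & m = [multinom (m' : 'X_{1..n}) (s k) | k < n]])
          ((j, m') \in coef_orbit i m).
Proof.
rewrite inE; apply: (iffP existsP) => -[s].
  case/and3P=> /forallP sp /eqP /= -> /eqP ->.
  by exists s; split=> [k||]; rewrite ?(eqP (sp k)).
case=> sp -> ->; exists s; rewrite !eqxx !andbT.
by apply/forallP => k; rewrite sp.
Qed.

Lemma coef_orbit_msym (s : 'S_n) (i : 'I_n) (m : 'X_{1..n}) :
  preserves_block p s ->
  coef_orbit (s i) m = coef_orbit i [multinom m (s k) | k < n].
Proof.
move=> sp; apply/setP => -[j m'].
apply/coef_orbitP/coef_orbitP => -[t [tp -> em]].
  exists (s * t)%g; split; last by rewrite em mpermM.
    by move=> k; rewrite permM tp sp.
  by rewrite permM.
exists (s^-1 * t)%g; split; last by rewrite mpermM -em mpermKV.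
  by move=> k; rewrite permM tp -(sp (s^-1 k)%g) permKV.
by rewrite permM permK.
Qed.

(** One indeterminate per set of pairs; only those indexed by orbits occur in the
    universal system. *)
Definition universal_ring : comNzRingType := {mpoly int[#|{set bounded_pair}|]}.

Definition universal_coef (i : 'I_n) (m : 'X_{1..n}) : universal_ring :=
  if mdeg m == d then 'X_(enum_rank (coef_orbit i m)) else 0.

Definition universal_system (i : 'I_n) : {mpoly universal_ring[n]} :=
  \sum_(m : 'X_{1..n < d.+1}) universal_coef i m *: 'X_[m].

Lemma mcoeff_universal_system (i : 'I_n) (m : 'X_{1..n}) :
  (universal_system i)@_m = universal_coef i m.
Proof.
have [lt_md|lt_dm] := ltnP (mdeg m) d.+1; first exact: mcoeff_mpoly.
rewrite /universal_coef gtn_eqF // /universal_system raddf_sum big1 // => m' _.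
rewrite /= mcoeffZ mcoeffX; case: eqP => [em|_]; last by rewrite mulr0.
by have := bmdeg m'; rewrite em ltnNge lt_dm.
Qed.

Lemma universal_system_equivariant : equivariant_system universal_system d p.
Proof.
split=> [i|s sp i].
  apply/dhomogP => m; rewrite mcoeff_msupp mcoeff_universal_system.
  by rewrite /universal_coef; case: (mdeg m =P d) => // _; rewrite eqxx.
apply/mpolyP => m; rewrite mcoeff_sym !mcoeff_universal_system /universal_coef.
by rewrite mdeg_mperm coef_orbit_msym.
Qed.

Variables (R : comNzRingType) (F : 'I_n -> {mpoly R[n]}).

(** The value of F at an arbitrary element of the set. For an orbit it does not
    depend on the element; 0 is the value on the empty set. *)
Definition orbit_value (k : 'I_#|{set bounded_pair}|) : R :=
  if [pick jm in enum_val k] is Some jm then (F jm.1)@_jm.2 else 0.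

Definition universal_eval : universal_ring -> R :=
  mmap (intr : int -> R) orbit_value.

HB.instance Definition _ := GRing.RMorphism.on universal_eval.

Lemma universal_systemP : equivariant_system F d p ->
  base_change universal_eval universal_system F.
Proof.
move=> [homF eqF] i; apply/mpolyP => m.
rewrite mcoeff_map_mpoly mcoeff_universal_system /universal_coef.
have [md|md] := eqVneq (mdeg m) d; last first.
  by rewrite raddf0 (dhomog_nemf_coeff (homF i)).
rewrite [RHS](etrans (mmapX _ _ _) (mmap1U _ _)) /orbit_value enum_rankK.
case: pickP => [[j m'] /coef_orbitP[s [sp -> ->]]|none] /=.
  by rewrite -mcoeff_sym eqF.
have lt_md : (mdeg m < d.+1)%N by rewrite md.
have := none (i, BMultinom lt_md); case: coef_orbitP => // -[]; exists 1%g.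
by split=> [k||]; rewrite ?perm1 ?mperm1.
Qed.

End UniversalSystem.

(* The third hypothesis is the decomposition formula, with a sign that may
   depend on the ring and on the system.  As eps and - eps give the same formula
   when 2 P(F) = 0, a system determines the sign iff 2 P(F) <> 0; this is
   P(F) <> 0 as soon as 2 is not a zero divisor in the ring of coefficients. *)
Theorem lemma3p7 (n d p : nat) (hn : (2 <= n)%N) (hd : (1 <= d)%N)
    (hp : (1 <= p < n)%N)
    (decomposition : forall (R : comNzRingType) (F : 'I_n -> {mpoly R[n]}),
       equivariant_system F d p ->
       exists eps : int, is_sign eps /\ decomposition_with_sign d p F eps) :
  (exists eps : int,
     [/\ is_sign eps,
         forall (R : comNzRingType) (F : 'I_n -> {mpoly R[n]}),
           equivariant_system F d p -> decomposition_with_sign d p F eps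
       & forall (R : comNzRingType) (F : 'I_n -> {mpoly R[n]}) (eps' : int),
           equivariant_system F d p ->
           decomposition_product d p F *+ 2 <> 0 ->
           is_sign eps' -> decomposition_with_sign d p F eps' -> eps' = eps])
  /\
  (forall (R0 : comNzRingType) (F0 : 'I_n -> {mpoly R0[n]}) (eps0 : int),
     equivariant_system F0 d p ->
     decomposition_product d p F0 *+ 2 <> 0 ->
     is_sign eps0 -> decomposition_with_sign d p F0 eps0 ->
     forall (R : comNzRingType) (F : 'I_n -> {mpoly R[n]}),
       equivariant_system F d p -> decomposition_with_sign d p F eps0).
Proof.
have univ_eq := universal_system_equivariant n d p.
have [eps [eps_sign eps_univ]] := decomposition _ _ univ_eq.
have eps_all (R : comNzRingType) (F : 'I_n -> {mpoly R[n]}) :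
    equivariant_system F d p -> decomposition_with_sign d p F eps.
  move=> eqF; have [_ univ_equiv] := univ_eq.
  exact: decomposition_with_sign_base_change
    (universal_systemP eqF) univ_equiv eps_univ.
have eps_uniq (R : comNzRingType) (F : 'I_n -> {mpoly R[n]}) (eps' : int) :
    equivariant_system F d p -> decomposition_product d p F *+ 2 <> 0 ->
    is_sign eps' -> decomposition_with_sign d p F eps' -> eps' = eps.
  move=> eqF P2 eps'_sign; have := eps_all R F eqF.
  rewrite /decomposition_with_sign => -> e.
  case: eps_sign eps'_sign e => -> [] -> //;
    rewrite mulrN1z mulr1z mulN1r mul1r.
    by move=> e; case: P2; rewrite mulr2n {1}e addNr.
  by move=> e; case: P2; rewrite mulr2n -{1}e addNr.
split; first by exists eps.
move=> R0 F0 eps0 eqF0 P2 s0 e0 R F eqF.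
by rewrite (eps_uniq R0 F0 eps0) //; exact: eps_all.
Qed.
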